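(* Let $\mathbbm{I}=(\mathcal{F},\mathbb{M})$ be any CICS instance. Then $\mathrm{ComGap}(\mathbbm{I})\le\alpha(\mathcal{F})$, where $\alpha(\mathcal{F})=e/(e-1)$ if $\mathcal{F}$ is the family of independent sets of a matroid on $[n]$; $\alpha(\mathcal{F})=k+1$ if $\mathcal{F}$ is a $k$-system; and $\alpha(\mathcal{F})=3.135$ if $\mathcal{F}$ is a knapsack constraint.
   Context: CICS: an instance $\mathbbm{I}=(\mathcal{F},\mathbb{M})$ consists of a downwards-closed $\mathcal{F}\subseteq 2^{[n]}$ and $n$ acyclic Markov decision processes $\mathcal{M}_i$, each with a finite state set, root $\sigma_i$, actions $A_i(s)$ with nonnegative costs $c_i(a)$ and transition distributions $\Pi_i(s,a)$, and sink (terminal) states $T_i$ with values $v_i(t)\ge0$. A policy starts with all MDPs at their roots and repeatedly (adaptively) either advances some MDP in a non-terminal state by an action (paying its cost, random transition), or halts by selecting $S\in\mathcal{F}$ among MDPs currently in terminal states, collecting $\sum_{i\in S}v_i(s_i)$; its utility is expected collected value minus expected cost, and $\mathrm{OPT}(\mathbbm{I})$ is the optimal utility. A commitment $(\pi_1,\dots,\pi_n)$ assigns each state $s$ of $\mathcal{M}_i$ a distribution $\pi_i(s)$ over $A_i(s)$; a committing policy draws its action from $\pi_i(s)$ whenever it advances $\mathcal{M}_i$ at state $s$. $\mathrm{ComGap}(\mathbbm{I})=\mathrm{OPT}(\mathbbm{I})/\sup\{\mathrm{Util}(\mathcal{T}):\mathcal{T}\text{ committing}\}$. A $k$-system is a family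 $\mathcal{F}\subseteq 2^{[n]}$ such that for every $S\subseteq[n]$, $\max_{A\in B(S)}|A|\le k\min_{A\in B(S)}|A|$, where $B(S)$ is the set of maximal members of $\mathcal{F}$ contained in $S$. A knapsack constraint is $\mathcal{F}=\{S\subseteq[n]:\sum_{i\in S}s_i\le1\}$ for sizes $s\in[0,1]^n$. *)

(* Defs.v *)
From HB Require Import structures.
From mathcomp Require Import all_boot all_order all_algebra.
From mathcomp Require Import boolp classical_sets reals sequences exp.
Set Implicit Arguments. Unset Strict Implicit. Unset Printing Implicit Defensive.
Import Order.TTheory GRing.Theory Num.Theory.
Local Open Scope ring_scope.

Record cics (R : realType) (n : nat) := CICS {
  St    : 'I_n -> finType;
  Act   : 'I_n -> finType;
  root  : forall i, St i;
  avail : forall i, St i -> {set Act i};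
  cost  : forall i, Act i -> R;
  trans : forall i, St i -> Act i -> St i -> R;
  term  : forall i, {set St i};
  val   : forall i, St i -> R;                  (* v_i(t) (used on T_i) *)
  fam   : {set {set 'I_n}}
}.

Arguments St {R n} c i.
Arguments Act {R n} c i.
Arguments root {R n} c i.
Arguments avail {R n} c {i} s.
Arguments cost {R n} c {i} a.
Arguments trans {R n} c {i} s a s'.
Arguments term {R n} c i.
Arguments val {R n} c {i} s.
Arguments fam {R n} c.

Section Semantics.
Variables (R : realType) (n : nat) (I : cics R n).

Definition edge (i : 'I_n) : rel (St I i) :=
  fun s s' => [exists a in avail I s, 0 < trans I s a s'].

Definition wf_cics : Prop :=
  [/\
      (forall A B : {set 'I_n}, B \in fam I -> A \subset B -> A \in fam I) /\
      finset.set0 \in fam I,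
      (forall i (s : St I i), (s \in term I i) = (avail I s == finset.set0)),
      (forall i (a : Act I i), 0 <= cost I a) /\
      (forall i (t : St I i), t \in term I i -> 0 <= val I t),
      (forall i (s : St I i) a, a \in avail I s ->
          (forall s', 0 <= trans I s a s') /\ \sum_(s' : St I i) trans I s a s' = 1)
    &
      (forall i (s s' : St I i), edge s s' -> ~~ connect (@edge i) s' s)].

Definition jstate := forall i : 'I_n, St I i.
Definition root_state : jstate := fun i => root I i.

(* history: sequence of (action taken in some M_i, resulting joint state) *)
Definition history := seq ({i : 'I_n & Act I i} * jstate).

(* an upper bound on the number of steps of any run (MDPs are acyclic) *)
Definition horizon : nat := (\sum_(i < n) #|St I i|).+1.

(* a decision: halt selecting S, or advance M_i by action a *)
Definition decision := ({set 'I_n} + {i : 'I_n & Act I i})%type.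

Definition valid_decision (x : jstate) (d : decision) : bool :=
  match d with
  | inl A => (A \in fam I) && [forall i in A, x i \in term I i]
  | inr (existT i a) => (x i \notin term I i) && (a \in avail I (x i))
  end.

Definition policy := history -> jstate -> {ffun decision -> R}.

Definition valid_policy (P : policy) : Prop :=
  forall h x, (forall d, 0 <= P h x d) /\ \sum_d P h x d = 1 /\
              (forall d, 0 < P h x d -> valid_decision x d).

Definition collect (x : jstate) (S : {set 'I_n}) : R :=
  \sum_(i in S) val I (x i).

Fixpoint util_rec (P : policy) (fuel : nat) (h : history) (x : jstate) : R :=
  match fuel with
  | 0 => 0
  | fuel'.+1 =>
    \sum_(d : decision) P h x d *
      match d with
      | inl A => collect x A
      | inr (existT i a) =>
          - cost I a + \sum_(s' : St I i) trans I (x i) a s' *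
              util_rec P fuel' (rcons h (existT _ i a, dfwith x s')) (dfwith x s')
      end
  end.

Definition Util (P : policy) : R := util_rec P horizon [::] root_state.

Definition OPT : R := sup [set u | exists2 P, valid_policy P & u = Util P].

Definition commitment := forall i : 'I_n, St I i -> {ffun Act I i -> R}.

Definition valid_commitment (pi : commitment) : Prop :=
  forall i (s : St I i), s \notin term I i ->
    (forall a, 0 <= pi i s a) /\ \sum_a pi i s a = 1 /\
    (forall a, 0 < pi i s a -> a \in avail I s).

(* a committing policy decides (adaptively, possibly randomly) to halt
   with S or to advance M_i; the action is then drawn from pi_i(s_i) *)
Definition cdecision := ({set 'I_n} + 'I_n)%type.

Definition valid_cdecision (x : jstate) (d : cdecision) : bool :=
  match d with
  | inl A => (A \in fam I) && [forall i in A, x i \in term I i]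
  | inr i => x i \notin term I i
  end.

Definition cpolicy := history -> jstate -> {ffun cdecision -> R}.

Definition valid_cpolicy (Q : cpolicy) : Prop :=
  forall h x, (forall d, 0 <= Q h x d) /\ \sum_d Q h x d = 1 /\
              (forall d, 0 < Q h x d -> valid_cdecision x d).

Fixpoint cutil_rec (pi : commitment) (Q : cpolicy) (fuel : nat) (h : history)
    (x : jstate) : R :=
  match fuel with
  | 0 => 0
  | fuel'.+1 =>
    \sum_(d : cdecision) Q h x d *
      match d with
      | inl A => collect x A
      | inr i =>
          \sum_(a : Act I i) pi i (x i) a *
            (- cost I a + \sum_(s' : St I i) trans I (x i) a s' *
               cutil_rec pi Q fuel' (rcons h (existT _ i a, dfwith x s'))
                         (dfwith x s'))
      end
  end.

Definition CUtil (pi : commitment) (Q : cpolicy) : R :=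
  cutil_rec pi Q horizon [::] root_state.

Definition ComSup : R :=
  sup [set u | exists pi Q, [/\ valid_commitment pi, valid_cpolicy Q &
                                 u = CUtil pi Q]].

Definition ComGap : R := OPT / ComSup.

(* ComGap <= alpha, also stated division-free (ComGap = +oo if ComSup = 0
   and OPT > 0 in the paper's reading) *)
Definition comgap_le (alpha : R) : Prop :=
  ComGap <= alpha /\ OPT <= alpha * ComSup.

End Semantics.

Section Families.
Variables (R : realType) (n : nat).

Definition matroid_indep (F : {set {set 'I_n}}) : Prop :=
  [/\ finset.set0 \in F,
      (forall A B : {set 'I_n}, B \in F -> A \subset B -> A \in F) &
      (forall A B : {set 'I_n}, A \in F -> B \in F -> #|A| < #|B| ->
         exists2 x, x \in B :\: A & x |: A \in F)]%N.

Definition bases_in (F : {set {set 'I_n}}) (S : {set 'I_n}) : {set {set 'I_n}} :=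
  [set A in F | (A \subset S) &&
      [forall A' in F, ((A \proper A') && (A' \subset S)) ==> false]].

Definition k_system (k : nat) (F : {set {set 'I_n}}) : Prop :=
  forall S : {set 'I_n}, forall A A', A \in bases_in F S -> A' \in bases_in F S ->
    (#|A| <= k * #|A'|)%N.

Definition knapsack (F : {set {set 'I_n}}) : Prop :=
  exists s : 'I_n -> R, (forall i, 0 <= s i <= 1) /\
    (forall S : {set 'I_n}, (S \in F) = (\sum_(i in S) s i <= 1)).

End Families.

(* Main.v *)
Require Import Defs.
From HB Require Import structures.
From mathcomp Require Import all_boot all_order all_algebra.
From mathcomp Require Import boolp classical_sets functions reals sequences exp.
From mathcomp Require Import topology normedtype derive realfun.
From mathcomp Require Import ring lra fintype finset.
Set Implicit Arguments. Unset Strict Implicit. Unset Printing Implicit Defensive.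
Import Order.TTheory GRing.Theory Num.Theory.
Import numFieldNormedType.Exports.
Local Open Scope ring_scope.

(** Ex-ante relaxation.  For a policy [P] let [y i s a] and [z i s] be the
    expected number of times that [P] plays [a] in state [s] of the [i]-th MDP,
    resp. halts with [i] selected in state [s].  These numbers form a flow, so
    the commitment that plays [a] in [s] with probability proportional to
    [y i s a] can imitate, on the [i]-th MDP alone, the behaviour of [P]: it
    accepts with probability [x i = \sum_s z i s] and earns the contribution
    [w i] of [i] to the utility of [P].  The vector [x] is a convex combination
    of indicators of members of [F].

    It then suffices to process the MDPs one after the other, each either
    entirely or not at all, so that the accepted set stays in [F]: items of
    known value [w i / x i] are active independently with probability [x i],
    and the order is ours.
    - matroid: the greedy order, and the correlation gap of the rank function;
    - k-system: the greedy order; the blocked items have total [x]-weight at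
      most [k] times the number of accepted ones;
    - knapsack: posted prices proportional to the size, capped at size 1/2,
      offered first to the items of size above 1/2.  This even gives 3.

    The sequential procedure is compared directly with the Bellman value of the
    commitment: shifted by the value of giving up on the current MDP, the latter
    is a nonnegative superharmonic function of the state of that MDP, and summing
    its local inequalities against the flow bounds its value at the root. *)

(** * Values of sequential probing and the ex-ante polytope *)

Section Probing.
Variables (R : realType) (n : nat) (F : {set {set 'I_n}}).
Implicit Types (x w u : 'I_n -> R) (L : seq 'I_n) (G D A B S : {set 'I_n}) (i : 'I_n).

(** [w i] is the unconditional expected utility of item [i], so it is not multiplied by [x i]. The
    maximum with [skip] allows a fitting item to be passed over, so unprofitable items do no
    harm. *)
Fixpoint probe_value x w L G : R :=
  if L is i :: L' then
    let skip := probe_value x w L' G in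
    if i |: G \in F then
      Num.max (w i + x i * probe_value x w L' (i |: G) + (1 - x i) * skip) skip
    else skip
  else 0.

Lemma probe_value_ge0 x w L G : 0 <= probe_value x w L G.
Proof.
elim: L G => //= i L IH G; case: ifP => // _.
by rewrite le_max IH orbT.
Qed.

Lemma probe_value_skip x w i L G :
  probe_value x w L G <= probe_value x w (i :: L) G.
Proof. by rewrite /=; case: ifP => // _; rewrite le_max lexx orbT. Qed.

Lemma probe_value_try x w i L G : i |: G \in F ->
  w i + x i * probe_value x w L (i |: G) + (1 - x i) * probe_value x w L G
    <= probe_value x w (i :: L) G.
Proof. by move=> /= ->; rewrite le_max lexx. Qed.

Hypothesis F_down : forall A B, B \in F -> A \subset B -> A \in F.

(** The mass is only bounded by one, so no proof that a run surely halts is needed to establish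
    it. *)
Definition ex_ante x : Prop :=
  exists p : {set 'I_n} -> R,
    [/\ forall A, 0 <= p A, forall A, A \notin F -> p A = 0,
        \sum_A p A <= 1 & forall i, x i = \sum_(A : {set 'I_n} | i \in A) p A].

Lemma ex_ante_bounds x : ex_ante x -> forall i, 0 <= x i <= 1.
Proof.
move=> [p [p0 _ p1 xE]] i; rewrite xE sumr_ge0 //=.
apply: le_trans p1.
rewrite [leRHS](bigID (fun A : {set 'I_n} => i \in A)) /= lerDl.
by rewrite sumr_ge0.
Qed.

(** Linear inequalities valid on all members of [F] pass to their mixture [x]; [0 <= c] absorbs the
    missing mass. *)
Lemma ex_ante_sum_le x D c (s : 'I_n -> R) : ex_ante x -> 0 <= c ->
  (forall A, A \in F -> \sum_(i in A :&: D) s i <= c) ->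
  \sum_(i in D) s i * x i <= c.
Proof.
move=> [p [p0 pF p1 xE]] c0 H.
have -> : \sum_(i in D) s i * x i = \sum_A p A * \sum_(i in A :&: D) s i.
  under eq_bigr => i _ do rewrite xE mulr_sumr big_mkcond.
  rewrite exchange_big /=; apply: eq_bigr => A _.
  rewrite mulr_sumr big_mkcond [RHS]big_mkcond /=; apply: eq_bigr => i _.
  by rewrite inE andbC; case: ifP => //= iD; case: ifP => // _; rewrite mulrC.
apply: (@le_trans _ _ (\sum_A p A * c)); last first.
  by rewrite -mulr_suml; apply: le_trans (ler_wpM2r c0 p1) _; rewrite mul1r.
apply: ler_sum => A _; case: (boolP (A \in F)) => AF.
  exact: ler_wpM2l (H A AF).
by rewrite (pF A AF) !mul0r.
Qed.

(** * Greedy probing for k-systems *)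

Section KSystem.
Variable (k : nat).
Hypothesis kF : k_system k F.

(** Inside [G :|: D] the set [G] is maximal, since every [d] in [D] is blocked, whereas [A :&: D]
    extends to some maximal member; the k-system property compares the two cardinalities. *)
Lemma blocked_weight x G D : ex_ante x -> G \in F ->
  (forall d, d \in D -> d |: G \notin F) -> \sum_(i in D) x i <= k%:R * #|G|%:R.
Proof.
move=> xF GF blk.
have -> : \sum_(i in D) x i = \sum_(i in D) 1 * x i.
  by apply: eq_bigr => i _; rewrite mul1r.
apply: (ex_ante_sum_le (s := fun=> 1) xF) => [|A AF]; first by rewrite mulr_ge0.
rewrite sumr_const -natrM ler_nat.
pose P := fun B : {set 'I_n} => (B \in F) && (B \subset G :|: D).
have PAD : P (A :&: D).
  rewrite /P (F_down AF (subsetIl A D)) /=.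
  exact: subset_trans (subsetIr A D) (subsetUr G D).
have [B Bmax AB] := maxset_exists PAD.
have /maxsetP[/andP[BF BS] Bm] := Bmax.
apply: leq_trans (subset_leq_card AB) _.
apply: (kF (S := G :|: D)).
  rewrite inE BF BS /=; apply/forall_inP => C CF; rewrite implybF.
  apply/negP => /andP[BC CS].
  have := Bm C; rewrite /P CF CS => /(_ isT (proper_sub BC)) CB.
  by move: BC; rewrite CB properxx.
rewrite inE GF subsetUl /=; apply/forall_inP => C CF; rewrite implybF.
apply/negP => /andP[/properP[GC [d dC dG]] CS].
have dD : d \in D by move/subsetP/(_ d dC): CS; rewrite inE (negbTE dG).
have /negP := blk d dD; apply; apply: F_down CF _.
by rewrite subUset sub1set dC.
Qed.

(** A charging argument with [D] the items blocked so far: each accepted item deposits a credit of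
    [k] units, each blocked item withdraws [x i], and a unit is worth the current density bound [U].
    By [blocked_weight] the credit never becomes negative. *)
Lemma greedy_ksystem x w u L G D U : ex_ante x -> 0 <= U ->
  (forall i, i \in L -> w i = u i * x i /\ 0 <= u i <= U) ->
  sorted (fun i j => u j <= u i) L -> uniq L -> G \in F ->
  (forall i, i \in L -> (i \notin G) && (i \notin D)) ->
  (forall d, d \in D -> d |: G \notin F) ->
  \sum_(i <- L) w i <=
    U * (k%:R * #|G|%:R - \sum_(i in D) x i) + (k%:R + 1) * probe_value x w L G.
Proof.
move=> xF; elim: L G D U => [|i L IH] G D U U0 Lw srt unq GF dis blk.
  by rewrite big_nil /= mulr0 addr0 mulr_ge0 // subr_ge0 blocked_weight.
have [wi /andP[ui0 uiU]] := Lw i (mem_head i L).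
have Lw' j : j \in L -> w j = u j * x j /\ 0 <= u j <= u i.
  move=> jL; have [-> /andP[uj0 _]] := Lw j (mem_behead (s := i :: L) jL).
  split=> //; rewrite uj0 /=.
  have tr : transitive (fun i j => u j <= u i).
    by move=> a b c ab bc; apply: le_trans bc ab.
  by move: srt => /= /(order_path_min tr) /allP; apply.
have srt' := path_sorted srt.
have /andP[iL uL] : (i \notin L) && uniq L by [].
have /andP[iG iD] := dis i (mem_head i L).
have dis' j : j \in L -> (j \notin G) && (j \notin D) && (j != i).
  move=> jL; rewrite (dis j (mem_behead (s := i :: L) jL)) /=.
  by apply: contraNneq iL => <-.
have sl := blocked_weight xF GF blk.
(* The credit is nonnegative, so its unit price may be lowered from [U] to [u i]. *)
apply: (@le_trans _ _ (u i * (k%:R * #|G|%:R - \sum_(i in D) x i) +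
    (k%:R + 1) * probe_value x w (i :: L) G)); last first.
  by rewrite lerD2r ler_wpM2r // subr_ge0.
rewrite big_cons; have /andP[x0 x1] := ex_ante_bounds xF i.
have [iGF|iGF] := boolP (i |: G \in F); last first.
  (* A blocked [i] joins [D]; the withdrawal [u i * x i] pays exactly for [w i]. *)
  have disD j : j \in L -> (j \notin G) && (j \notin i |: D).
    by move=> /dis' /andP[/andP[-> jD] ji]; rewrite !inE negb_or jD ji.
  have blkD d : d \in i |: D -> d |: G \notin F.
    by rewrite !inE => /orP[/eqP->|/blk].
  have := IH G (i |: D) (u i) ui0 Lw' srt' uL GF disD blkD.
  by rewrite big_setU1 //= (negbTE iGF) wi; lra.
have H1 := IH (i |: G) D (u i) ui0 Lw' srt' uL iGF.
have H2 := IH G D (u i) ui0 Lw' srt' uL GF.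
have {}H1 : \sum_(i0 <- L) w i0 <= u i * (k%:R * #|i |: G|%:R - \sum_(i1 in D) x i1)
    + (k%:R + 1) * probe_value x w L (i |: G).
  apply: H1.
  - by move=> j /dis' /andP[/andP[jG ->] ji]; rewrite !inE negb_or ji jG.
  - move=> d /blk; apply: contra => H; apply: F_down H _.
    by rewrite setUCA subsetUr.
have {}H2 : \sum_(i0 <- L) w i0 <= u i * (k%:R * #|G|%:R - \sum_(i1 in D) x i1)
    + (k%:R + 1) * probe_value x w L G.
  by apply: H2 => // j /dis' /andP[].
have T := probe_value_try x w L iGF.
rewrite cardsU1 iG natrD /= in H1.
set Pn := probe_value x w (i :: L) G in T *.
have {}T := ler_wpM2l (_ : 0 <= k%:R + 1 :> R) T.
have {}T := T (addr_ge0 (ler0n _ _) ler01).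
(* Averaging the two outcomes, acceptance adds credit worth [k * u i * x i = k * w i]; together with
   [w i] itself this is the term [(k + 1) * w i] supplied by [T]. *)
have {}H1 := ler_wpM2l x0 H1.
have x1' : 0 <= 1 - x i by rewrite subr_ge0.
have {}H2 := ler_wpM2l x1' H2.
move: H1 H2 T; rewrite wi.
set a := \sum_(j <- L) _; set b := \sum_(j in D) _.
by nra.
Qed.

End KSystem.

(** Only items with [0 < w i] are kept: dropping the others cannot decrease the sum, and on the kept
    ones the density [w i / x i] is meaningful. *)
Lemma decreasing_density x w : (forall i, 0 < w i -> 0 < x i) ->
  exists L u, [/\ uniq L, sorted (fun i j => u j <= u i) L,
    forall i, i \in L -> w i = u i * x i /\ 0 <= u i &
    \sum_i w i <= \sum_(i <- L) w i].
Proof.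
move=> wx; pose u i := w i / x i.
pose L := sort (fun i j => u j <= u i) [seq i <- enum 'I_n | 0 < w i].
have memL i : (i \in L) = (0 < w i).
  by rewrite mem_sort mem_filter mem_enum andbT.
exists L, u; split.
- by rewrite sort_uniq filter_uniq ?enum_uniq.
- by apply: sort_sorted => i j; apply: le_total.
- move=> i; rewrite memL => wi; have xi := wx i wi.
  by rewrite /u mulfVK ?gt_eqF // divr_ge0 // ltW.
rewrite (perm_big _ (introT permPl (perm_sort _ _))) /= big_filter big_enum_cond /=.
rewrite [leLHS](bigID (fun i => 0 < w i)) /= gerDl sumr_le0 // => i.
by rewrite -leNgt.
Qed.

Lemma probe_ksystem k x w : k_system k F -> finset.set0 \in F -> ex_ante x ->
  (forall i, 0 < w i -> 0 < x i) ->
  exists2 L, uniq L &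
    \sum_i w i <= (k%:R + 1) * probe_value x w L finset.set0.
Proof.
move=> kF F0 xF wx; have [L [u [uL sL Lw le_w]]] := decreasing_density wx.
exists L => //; apply: le_trans le_w _.
(* Any upper bound on the densities would do: the initial credit is zero, so [U] cancels. *)
pose U := \sum_(i <- L) `|u i|.
have U0 : 0 <= U by apply: sumr_ge0.
have := @greedy_ksystem k kF x w u L finset.set0 finset.set0 U xF U0.
rewrite cards0 big_set0 mulr0 subrr mulr0 add0r; apply => //.
- move=> i iL; have [-> ui] := Lw i iL; split=> //; rewrite ui /=.
  rewrite /U (big_rem i) //= ger0_norm // lerDl.
  exact: sumr_ge0.
- by move=> i _; rewrite !inE.
- by move=> d; rewrite inE.
Qed.

(** * Posted prices for a knapsack *)

Section Knapsack.
Variable s : 'I_n -> R.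
Hypothesis s01 : forall i, 0 <= s i <= 1.
Hypothesis Fs : forall A, (A \in F) = (\sum_(i in A) s i <= 1).

Let big i := 1 / 2%:R < s i.
(** This is [2 * tau * min (s i) (1/2)]: a revenue below [tau] means that less than half of the
    knapsack is filled. *)
Let price tau i : R := if big i then tau else 2%:R * tau * s i.

Lemma price_ge0 tau i : 0 <= tau -> 0 <= price tau i.
Proof.
move=> t0; have /andP[s0 _] := s01 i.
by rewrite /price; case: ifP => // _; rewrite !mulr_ge0.
Qed.

(** A single big item already brings revenue [tau], so [G] has only small items, of total size below
    1/2. A small [i] adds at most 1/2; for a big [i] the order hypothesis leaves [G] empty. *)
Lemma cheap_fits tau i G : 0 < tau -> i \notin G ->
  (forall j, j \in G -> big i -> big j) ->
  \sum_(j in G) price tau j < tau -> i |: G \in F.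
Proof.
move=> t0 iG GB lt; rewrite Fs big_setU1 //=.
have small j : j \in G -> ~~ big j.
  move=> jG; apply/negP => bj; move: lt.
  rewrite (bigD1 j) //= {1}/price bj ltNge lerDl sumr_ge0 // => l _.
  exact/price_ge0/ltW.
have /andP[_ si1] := s01 i.
have [bi|sbi] := boolP (big i).
  rewrite big1 ?addr0 // => j jG.
  by have := small j jG; rewrite (GB j jG bi).
have : \sum_(j in G) price tau j = 2%:R * tau * \sum_(j in G) s j.
  rewrite mulr_sumr; apply: eq_bigr => j jG.
  by rewrite /price (negbTE (small j jG)).
move=> E; rewrite E in lt; move: sbi; rewrite /big -leNgt => sbi.
have : \sum_(j in G) s j < 1 / 2%:R.
  by rewrite -(ltr_pM2l (_ : 0 < 2%:R * tau)) ?mulr_gt0 //; apply: lt_le_trans lt _; lra.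
by lra.
Qed.

(* [C] accumulates the utility of the MDPs already offered; as long as the
   revenue is below [tau] nothing has been blocked. *)
Lemma posted_price x w tau L G C : (forall i, 0 <= x i <= 1) -> 0 < tau ->
  uniq L -> (forall i, i \in L -> i \notin G) ->
  pairwise (fun i j => big j ==> big i) L ->
  (forall i j, i \in L -> j \in G -> big i -> big j) ->
  0 <= C ->
  (tau <= \sum_(i in G) price tau i) \/
  (tau <= C + \sum_(i <- L) Num.max 0 (w i - price tau i * x i)) ->
  tau <= \sum_(i in G) price tau i + C + probe_value x w L G.
Proof.
move=> x01 t0; elim: L G C => [|i L IH] G C.
  move=> _ _ _ _ C0; rewrite big_nil /= !addr0 => -[H|H].
    by apply: le_trans H _; rewrite lerDl.
  apply: le_trans H _; rewrite lerDr sumr_ge0 // => i _.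
  exact/price_ge0/ltW.
move=> unq LG pw GB C0 H.
have [tG|Gt] := leP tau (\sum_(i in G) price tau i).
  apply: le_trans tG _; rewrite -addrA lerDl addr_ge0 //.
  exact: probe_value_ge0.
case: H => [|H]; first by rewrite leNgt Gt.
have /andP[iL uL] : (i \notin L) && uniq L by [].
have /andP[/allP iB pL] : all (fun j => big j ==> big i) L &&
  pairwise (fun i j => big j ==> big i) L by [].
have iG := LG i (mem_head i L).
have LG' j : j \in L -> j \notin G.
  by move=> jL; apply: LG; rewrite inE jL orbT.
have GB' a b : a \in L -> b \in G -> big a -> big b.
  by move=> aL; apply: GB; rewrite inE aL orbT.
rewrite big_cons in H.
have [np|pp] := leP (w i - price tau i * x i) 0.
  have H' : tau <= C + \sum_(i <- L) Num.max 0 (w i - price tau i * x i).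
    by move: H; rewrite max_l // add0r.
  apply: le_trans (IH G C uL LG' pL GB' C0 (or_intror H')) _.
  by rewrite lerD2l probe_value_skip.
rewrite (max_r (ltW pp)) in H.
have fit : i |: G \in F.
  by apply: (cheap_fits t0 iG) => // j jG; apply: GB => //; apply: mem_head.
apply: le_trans (lerD (lexx _) (probe_value_try x w L fit)).
(* [w i] splits into a surplus, credited to [C] on both outcomes, and the price, which enters the
   revenue only upon acceptance, hence with probability [x i]. *)
pose C' := C + (w i - price tau i * x i).
have C'0 : 0 <= C' by rewrite addr_ge0 // ltW.
rewrite addrA in H.
have H2 := IH G C' uL LG' pL GB' C'0 (or_intror H).
have H1 : tau <= \sum_(i0 in i |: G) price tau i0 + C' + probe_value x w L (i |: G).
  apply: IH => //; last by right.
    move=> j jL; rewrite !inE negb_or LG' // andbT.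
    by apply: contraNneq iL => <-.
  move=> a b aL; rewrite !inE => /orP[/eqP->|]; last exact: GB'.
  by have := iB a aL; move/implyP.
rewrite big_setU1 //= in H1.
have /andP[x0 x1] := x01 i.
have x1' : 0 <= 1 - x i by rewrite subr_ge0.
have {}H1 := ler_wpM2l x0 H1.
have {}H2 := ler_wpM2l x1' H2.
move: H1 H2; rewrite /C'.
move: (probe_value _ _ _ _) (probe_value _ _ _ _) (\sum_(j in G) _) => a b c.
by nra.
Qed.

Lemma probe_knapsack x w : ex_ante x -> exists2 L, uniq L &
    \sum_i w i <= 3%:R * probe_value x w L finset.set0.
Proof.
move=> xF; have [W0|W0] := leP (\sum_i w i) 0.
  by exists [::] => //=; rewrite mulr0.
(* The value with [W - 2 * tau = tau] for [W] the sum of the [w i]: the prices cost at most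
   [2 * tau] in expectation, so the surpluses sum to at least [tau]. *)
pose tau := (\sum_i w i) / 3%:R.
have t0 : 0 < tau by rewrite divr_gt0.
(* Big items come first, as [cheap_fits] requires. *)
pose L := [seq i <- enum 'I_n | big i] ++ [seq i <- enum 'I_n | ~~ big i].
have pL : perm_eq L (enum 'I_n).
  exact: (introT permPl (perm_filterC big (enum 'I_n))).
have uL : uniq L by rewrite (perm_uniq pL) enum_uniq.
exists L => //.
have := @posted_price x w tau L finset.set0 0 (ex_ante_bounds xF) t0 uL.
rewrite big_set0 !add0r => H.
suff : tau <= probe_value x w L finset.set0 by rewrite /tau; lra.
apply: H => //.
- by move=> i _; rewrite inE.
- have tru l : pairwise (fun _ _ : 'I_n => true) l.
    by elim: l => //= a l ->; rewrite andbT; apply/allP.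
  rewrite pairwise_cat; apply/and3P; split.
  + apply/allrelP => a b; rewrite !mem_filter => /andP[-> _] _.
    exact: implybT.
  + apply: (sub_in_pairwise (P := big) (r := fun _ _ => true)).
    - by move=> a b /= aB bB _; rewrite [big a]aB implybT.
    - exact: filter_all.
    - exact: tru.
  + apply: (sub_in_pairwise (P := predC big) (r := fun _ _ => true)).
    - by move=> a b /= aB bB _; rewrite [big b](negbTE bB).
    - exact: filter_all.
    - exact: tru.
- by move=> i j _; rewrite inE.
right; rewrite (perm_big _ pL) /= big_enum /=.
have sx : \sum_i s i * x i <= 1.
  have := @ex_ante_sum_le x finset.setT 1 s xF ler01.
  under eq_bigl => i do rewrite inE.
  apply => A; rewrite finset.setIT => AF.
  by rewrite -Fs.
apply: (@le_trans _ _ (\sum_i (w i - 2%:R * tau * (s i * x i)))).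
  rewrite sumrB -mulr_sumr /tau.
  have := ler_wpM2l (ltW t0) sx; rewrite /tau; lra.
apply: ler_sum => i _; rewrite le_max; apply/orP; right.
rewrite lerD2l lerN2 mulrA ler_wpM2r //.
  by case/andP: (ex_ante_bounds xF i).
(* A big item has [1 < 2 * s i], so its capped price is also at most [2 * tau * s i]. *)
rewrite /price /big; case: ifP => //= bi.
by move: t0 bi; nra.
Qed.

End Knapsack.
End Probing.

(* Integrating factor: [expR t * (f t - c)] is nondecreasing. *)
Lemma gronwall01 (R : realType) (f f' : R -> R) (c : R) :
  (forall t : R, is_derive t 1 f (f' t)) ->
  (forall t : R, 0 <= t <= 1 -> c <= f' t + f t) ->
  (expR 1 - 1) * c <= expR 1 * f 1 - f 0.
Proof.
move=> fd H.
pose h t := expR t * (f t - c).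
have hd (t : R) : is_derive t 1 h (expR t * (f' t + f t - c)).
  have := fd t => {}fd.
  have -> : h = (@expR R : R -> R) * (f - cst c) by [].
  apply: is_derive_eq.
  by rewrite /GRing.scale /= subr0 /cst /=; rewrite !fctE; ring.
suff : h 0 <= h 1 by rewrite /h expR0 mul1r; lra.
apply: (@ger0_derive1_ndecr R h 0 1) => //.
- by move=> t; rewrite in_itv /= => /andP[t0 t1]; rewrite derive1E derive_val mulr_ge0 ?expR_ge0 // subr_ge0 H // !ltW.
- by apply: derivable_within_continuous => t _; apply: ex_derive.
Qed.

(** * Independent sampling and the multilinear extension *)

Section Sampling.
Variables (R : realType) (n : nat).
Implicit Types (x q : 'I_n -> R) (L : seq 'I_n) (f g : {set 'I_n} -> R)
  (A G : {set 'I_n}).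

(* Expectation of [f (G :|: A)], with [A] containing each [i] of [L]
   independently with probability [q i]. *)
Fixpoint sample_mean q f L G : R :=
  if L is i :: L' then
    q i * sample_mean q f L' (i |: G) + (1 - q i) * sample_mean q f L' G
  else f G.

Lemma sample_meanD q f g L G :
  sample_mean q (fun A => f A + g A) L G = sample_mean q f L G + sample_mean q g L G.
Proof. by elim: L G => //= i L IH G; rewrite !IH; ring. Qed.

Lemma sample_mean_cst q c L G : sample_mean q (fun=> c) L G = c.
Proof. by elim: L G => //= i L IH G; rewrite !IH; ring. Qed.

Lemma sample_meanZ q c f L G :
  sample_mean q (fun A => c * f A) L G = c * sample_mean q f L G.
Proof. by elim: L G => //= i L IH G; rewrite !IH; ring. Qed.

Lemma sample_mean_setU1 q f i L G :
  sample_mean q f L (i |: G) = sample_mean q (fun A => f (i |: A)) L G.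
Proof. by elim: L G => //= j L IH G; rewrite finset.setUCA !IH. Qed.

Lemma le_sample_mean q f g L G : (forall i, 0 <= q i <= 1) ->
  (forall A, G \subset A -> f A <= g A) ->
  sample_mean q f L G <= sample_mean q g L G.
Proof.
move=> q01; elim: L G => [|i L IH] G le_fg /=; first exact: le_fg.
have /andP[q0 q1] := q01 i.
apply: lerD; apply: ler_wpM2l; rewrite ?subr_ge0 //; apply: IH => // A.
by move=> iGA; apply: le_fg; apply: subset_trans (subsetU1 _ _) iGA.
Qed.

Fixpoint sample_mean_deriv x (t : R) f L G : R :=
  if L is i :: L' then
    let q := fun j => t * x j in
    x i * (sample_mean q f L' (i |: G) - sample_mean q f L' G)
    + t * x i * sample_mean_deriv x t f L' (i |: G)
    + (1 - t * x i) * sample_mean_deriv x t f L' G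
  else 0.

Lemma is_derive_mixture (a t d1 d2 : R) (F1 F2 : R -> R) :
  is_derive t 1 F1 d1 -> is_derive t 1 F2 d2 ->
  is_derive t 1 (fun t : R => t * a * F1 t + (1 - t * a) * F2 t)
    (a * (F1 t - F2 t) + t * a * d1 + (1 - t * a) * d2).
Proof.
move=> dF1 dF2.
have da : is_derive t 1 (fun t : R => t * a) a.
  have -> : (fun t : R => t * a) = a \*: (@id R).
    by apply/funext => u /=; rewrite mulrC.
  by apply: is_derive_eq; rewrite /GRing.scale /= mulr1.
have da' := is_deriveB (is_derive_cst (1 : R) t 1) da.
apply: (is_derive_eq (is_deriveD (is_deriveM da dF1) (is_deriveM da' dF2))).
rewrite /GRing.scale /= /cst /= !fctE; ring.
Qed.

Lemma is_derive_sample_mean x f L G (t : R) :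
  is_derive t 1 (fun t : R => sample_mean (fun j => t * x j) f L G)
    (sample_mean_deriv x t f L G).
Proof.
elim: L G => [|i L IH] G /=; first exact: is_derive_cst.
exact: is_derive_mixture.
Qed.

(** The linearised growth of [f] at [A] when each [j] of [L] is added at rate [x j]. *)
Definition gain x f L A := \sum_(j <- L) x j * (f (j |: A) - f A).

(** The derivative compares [f] with and without [j], whatever the sample says about [j]; in the
    mean of [gain] the marginal of [j] vanishes when [j] is already sampled. Monotonicity makes the
    difference nonnegative. *)
Lemma gain_le_deriv x (t : R) f L G : (forall i, 0 <= x i <= 1) -> 0 <= t <= 1 ->
  (forall A i, f A <= f (i |: A)) ->
  sample_mean (fun j => t * x j) (gain x f L) L G <= sample_mean_deriv x t f L G.
Proof.
move=> x01 /andP[t0 t1] mono.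
have q01 i : 0 <= t * x i <= 1.
  by have /andP[x0 x1] := x01 i; rewrite mulr_ge0 //= mulr_ile1.
set q := fun j => t * x j.
have sub L' G' i : sample_mean q (fun A => f (i |: A) - f A) L' G' =
    sample_mean q f L' (i |: G') - sample_mean q f L' G'.
  rewrite sample_mean_setU1 -mulN1r -sample_meanZ -sample_meanD.
  by congr sample_mean; apply/funext => A; rewrite mulN1r.
elim: L G => [|i L IH] G; first by rewrite /= /gain big_nil.
have -> : gain x f (i :: L) = (fun A => x i * (f (i |: A) - f A) + gain x f L A).
  by apply/funext => A; rewrite /gain big_cons.
rewrite sample_meanD sample_meanZ sub /= -/q.
have -> : i |: (i |: G) = i |: G by rewrite finset.setUA finset.setUid.
have := IH (i |: G); have := IH G.
have /andP[x0 x1] := x01 i; have /andP[q0 q1] := q01 i.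
have q1' : 0 <= 1 - t * x i by rewrite subr_ge0.
move=> /(ler_wpM2l q1') H1 /(ler_wpM2l q0) H2.
have H3 : 0 <= sample_mean q f L (i |: G) - sample_mean q f L G.
  rewrite subr_ge0 sample_mean_setU1; apply: le_sample_mean => [j|A _]; first exact: q01.
  exact: mono.
rewrite -/(q i) in H1 H2 q0 q1' *.
have H4 : 0 <= x i * (q i * (sample_mean q f L (i |: G) - sample_mean q f L G)).
  by rewrite !mulr_ge0.
by lra.
Qed.

End Sampling.

(** * Matroid rank, its correlation gap, and the greedy order *)

Section Matroid.
Variables (R : realType) (n : nat) (F : {set {set 'I_n}}).
Implicit Types (x w u : 'I_n -> R) (L : seq 'I_n) (G D A B S : {set 'I_n}) (i : 'I_n).
Hypothesis mF : matroid_indep F.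

Let F_down A B : B \in F -> A \subset B -> A \in F.
Proof. by case: mF => _ H _; apply: H. Qed.

Definition rank A : nat := (\max_(S in F | S \subset A) #|S|)%N.

Lemma card_le_rank S A : S \in F -> S \subset A -> (#|S| <= rank A)%N.
Proof.
move=> SF SA; rewrite /rank; apply: (bigop.leq_bigmax_cond (F := fun B : {set (ordinal n)} => #|B|)); by rewrite SF.
Qed.

Lemma rank_witness A : exists2 S, S \in F & (S \subset A) /\ #|S| = rank A.
Proof.
have H : (0 < #|[pred S : {set 'I_n} | (S \in F) && (S \subset A)]|)%N.
  by apply/card_gt0P; exists finset.set0; rewrite inE sub0set andbT; case: mF.
have [S /andP[SF SA] E] := eq_bigmax_cond (fun S : {set 'I_n} => #|S|) H.
by exists S => //; split=> //; rewrite -E.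
Qed.

Lemma rank_mono A B : A \subset B -> (rank A <= rank B)%N.
Proof.
move=> AB; have [S SF [SA <-]] := rank_witness A.
exact: card_le_rank SF (subset_trans SA AB).
Qed.

Lemma rank_indep G : G \in F -> rank G = #|G|.
Proof.
move=> GF; apply/eqP; rewrite eqn_leq card_le_rank // andbT.
by have [S _ [SG <-]] := rank_witness G; apply: subset_leq_card.
Qed.

(** Extend [G] to a maximal independent subset of [i |: A]. By exchange it has full rank, and it
    avoids [i] because [i |: G] is dependent, so it lies in [A]. *)
Lemma rank_closure G A i : G \in F -> i |: G \notin F -> G \subset A ->
  (rank (i |: A) <= rank A)%N.
Proof.
move=> GF iGF GA; have [S SF [SA <-]] := rank_witness (i |: A).
pose P := fun B : {set 'I_n} => (B \in F) && (B \subset i |: A).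
have PG : P G by rewrite /P GF (subset_trans GA) // subsetU1.
have [B /maxsetP[/andP[BF BA] Bm] GB] := maxset_exists PG.
have SB : (#|S| <= #|B|)%N.
  rewrite leqNgt; apply/negP => ltBS.
  case: mF => _ _ /(_ B S BF SF ltBS)[y]; rewrite inE => /andP[yB yS] yF.
  have := Bm (y |: B); rewrite /P yF subUset sub1set (subsetP SA) // BA.
  by move=> /(_ isT (subsetU1 _ _)) E; move: yB; rewrite -E setU11.
apply: leq_trans SB (card_le_rank BF _); apply/subsetP => j jB.
have /setU1P[ji|//] := subsetP BA j jB.
case/negP: iGF; apply: F_down BF _.
by rewrite subUset sub1set -ji jB.
Qed.

(** Were [T] larger than a maximum independent subset of [A], exchange would add some [y] of [T] to
    that subset and raise the rank of [y |: A]. *)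
Lemma rank_closed_card T A : T \in F ->
  (forall j, j \in T -> (rank (j |: A) <= rank A)%N) -> (#|T| <= rank A)%N.
Proof.
move=> TF cl; have [S SF [SA ES]] := rank_witness A.
rewrite leqNgt -ES; apply/negP => ltST.
case: mF => _ _ /(_ S T SF TF ltST)[y]; rewrite inE => /andP[yS yT] yF.
have := leq_trans (card_le_rank yF (setUS [set y] SA)) (cl y yT).
by rewrite cardsU1 yS -ES ltnn.
Qed.

Let rk A : R := (rank A)%:R.

(** The claim is linear in [x], so it is checked on a member [S] of [F]: elements that raise the
    rank have coefficient at most 0, and those spanned by [A] number at most [rank A]. *)
Lemma gain_rank x L A : ex_ante F x -> uniq L ->
  \sum_(i <- L) x i <= gain x rk L A + rk A.
Proof.
move=> xF uL; rewrite -lerBlDl /gain -sumrB.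
have -> : \sum_(j <- L) (x j - x j * (rk (j |: A) - rk A)) =
    \sum_(j in [set j in L]) (1 - (rk (j |: A) - rk A)) * x j.
  rewrite big_uniq //=; apply: eq_big => [j|j _]; first by rewrite inE.
  by rewrite mulrBl mul1r mulrC.
apply: (ex_ante_sum_le xF) => [|S SF]; first exact: ler0n.
pose T := [set j in S :&: [set j in L] | (rank (j |: A) <= rank A)%N].
apply: (@le_trans _ _ #|T|%:R); last first.
  rewrite ler_nat; apply: rank_closed_card => [|j]; last by rewrite inE => /andP[].
  by apply: F_down SF _; apply/subsetP => j; rewrite !inE => /andP[/andP[]].
rewrite -sum1_card natr_sum (big_setID T) /= -[leRHS]addr0; apply: lerD.
  have -> : S :&: [set j in L] :&: T = T.
    by apply/setP => j; rewrite !inE; case: (j \in S); case: (j \in L).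
  apply: ler_sum => j _; rewrite gerBl subr_ge0 ler_nat.
  exact/rank_mono/subsetU1.
apply: sumr_le0 => j; rewrite !inE => /andP[jT jSL]; move: jT.
rewrite jSL /= -ltnNge => lt.
have : (rank A).+1%:R <= rk (j |: A) by rewrite ler_nat.
by rewrite /rk -addn1 natrD; lra.
Qed.

(** Every fitting item is taken, without the maximum of [probe_value]; this makes the value linear
    in [u], as Abel summation requires. *)
Fixpoint greedy_value x u L G : R :=
  if L is i :: L' then
    let skip := greedy_value x u L' G in
    if i |: G \in F then
      x i * (u i + greedy_value x u L' (i |: G)) + (1 - x i) * skip
    else skip
  else 0.

Lemma greedy_le_probe x w u L G : (forall i, 0 <= x i <= 1) ->
  (forall i, i \in L -> w i = u i * x i) ->
  greedy_value x u L G <= probe_value F x w L G.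
Proof.
move=> x01; elim: L G => //= i L IH G Lw.
have Lw' j : j \in L -> w j = u j * x j.
  by move=> jL; apply: Lw; rewrite inE jL orbT.
case: ifP => _; last exact: IH.
rewrite le_max Lw ?mem_head //; apply/orP; left.
have /andP[x0 x1] := x01 i.
have x1' : 0 <= 1 - x i by rewrite subr_ge0.
have := ler_wpM2l x0 (IH (i |: G) Lw').
have := ler_wpM2l x1' (IH G Lw').
by lra.
Qed.

Lemma greedy_valueD x u u' L G :
  greedy_value x (fun i => u i + u' i) L G =
  greedy_value x u L G + greedy_value x u' L G.
Proof.
by elim: L G => /= [|i L IH] G; rewrite ?addr0 // !IH; case: ifP => // _; ring.
Qed.

Lemma greedy_valueZ x c u L G :
  greedy_value x (fun i => c * u i) L G = c * greedy_value x u L G.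
Proof.
by elim: L G => /= [|i L IH] G; rewrite ?mulr0 // !IH; case: ifP => // _; ring.
Qed.

Lemma greedy_value_rcons x u L i G : u i = 0 ->
  greedy_value x u (rcons L i) G = greedy_value x u L G.
Proof.
move=> ui; elim: L G => /= [|j L IH] G; last by rewrite !IH.
by rewrite ui; case: ifP => // _; ring.
Qed.

(* Abel summation over the prefixes of the greedy order. *)
Lemma greedy_abel x u c L G :
  (forall L', uniq L' -> c * \sum_(i <- L') x i <= greedy_value x (fun=> 1) L' G) ->
  uniq L -> pairwise (fun i j => u j <= u i) L -> (forall i, i \in L -> 0 <= u i) ->
  c * \sum_(i <- L) u i * x i <= greedy_value x u L G.
Proof.
move=> H; elim/last_ind: L u => [|L i IH] u; first by rewrite big_nil mulr0.
move=> uL; rewrite pairwise_rcons => /andP[/allP ui pL] u0.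
have := uL; rewrite rcons_uniq => /andP[iL uL'].
(* Subtracting the smallest density, that of the last item, leaves densities that are still
   nonnegative and nonincreasing on [L] and vanish at [i]. *)
have -> : u = (fun j => u i * 1 + (u j - u i)).
  by apply/funext => j; rewrite mulr1 addrC subrK.
rewrite greedy_valueD (greedy_valueZ _ _ (fun=> 1)) (@greedy_value_rcons x (fun j => u j - u i)) ?subrr //.
have := IH (fun j => u j - u i) uL'.
have -> : pairwise (fun j k => u k - u i <= u j - u i) L.
  by apply: sub_pairwise pL => j k; rewrite lerD2r.
move=> /(_ isT) {}IH.
have {}IH := IH (fun j jL => etrans (subr_ge0 _ _) (ui j jL)).
have ui0 : 0 <= u i by apply: u0; rewrite mem_rcons mem_head.
have := ler_wpM2l ui0 (H _ uL).
rewrite -!cats1 !big_cat !big_seq1 /= mulr1 subrr addr0.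
have -> : \sum_(j <- L) (u i + (u j - u i)) * x j =
  u i * (\sum_(j <- L) x j) + \sum_(j <- L) (u j - u i) * x j.
  by rewrite mulr_sumr -big_split; apply: eq_bigr => j _; rewrite mulrDl.
by lra.
Qed.

(** The greedy set spans all sampled items: a blocked item lies in the closure of [G], so sampling
    it does not raise the rank. *)
Lemma sample_rank_le_greedy x L G : (forall i, 0 <= x i <= 1) -> G \in F ->
  sample_mean x rk L G <= #|G|%:R + greedy_value x (fun=> 1) L G.
Proof.
move=> x01; elim: L G => [|i L IH] G GF /=; first by rewrite /rk rank_indep ?addr0.
have /andP[x0 x1] := x01 i; have x1' : 0 <= 1 - x i by rewrite subr_ge0.
have H2 := ler_wpM2l x1' (IH G GF).
have [iGF|iGF] := boolP (i |: G \in F).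
  have H1 := ler_wpM2l x0 (IH _ iGF).
  have H3 : #|i |: G|%:R <= #|G|%:R + 1 :> R.
    by rewrite natr1 ler_nat cardsU1; case: (i \in G).
  have {}H3 := ler_wpM2l x0 H3.
  by lra.
have H1 : sample_mean x rk L (i |: G) <= sample_mean x rk L G.
  rewrite sample_mean_setU1; apply: le_sample_mean => // A GA.
  by rewrite ler_nat; apply: rank_closure GA.
have {}H1 := ler_wpM2l x0 H1.
have := IH G GF; lra.
Qed.

(** With [f t] the mean rank of a sample at rates [t * x j], [gain_rank] and [gain_le_deriv] bound
    [f' + f] below by the total of [x] on [[0, 1]]; [gronwall01] then bounds [f 1]. *)
Lemma greedy_matroid x L : ex_ante F x -> uniq L ->
  (1 - (expR 1)^-1) * \sum_(i <- L) x i <=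
  greedy_value x (fun=> 1) L finset.set0.
Proof.
move=> xF uL; have x01 := ex_ante_bounds xF.
have F0 : finset.set0 \in F by case: mF.
pose f t := sample_mean (fun j => t * x j) rk L finset.set0.
pose f' t := sample_mean_deriv x t rk L finset.set0.
have fd (t : R) : is_derive t 1 f (f' t) by apply: is_derive_sample_mean.
have lo (t : R) : 0 <= t <= 1 -> \sum_(i <- L) x i <= f' t + f t.
  move=> t01; have mono A i : rk A <= rk (i |: A).
    by rewrite ler_nat; apply/rank_mono/subsetU1.
  apply: (le_trans _ (lerD (gain_le_deriv L finset.set0 x01 t01 mono) (lexx _))).
  rewrite -sample_meanD -[leLHS](sample_mean_cst (fun j => t * x j) _ L finset.set0).
  apply: le_sample_mean => [i|A _]; last exact: gain_rank.
  have /andP[x0 x1] := x01 i; have /andP[t0 t1] := t01.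
  by rewrite mulr_ge0 //= mulr_ile1.
have := gronwall01 fd lo.
have -> : f 0 = 0.
  rewrite /f; have -> : (fun j => 0 * x j) = (fun=> 0) by apply/funext => j; rewrite mul0r.
  have : forall G, sample_mean (fun=> 0) rk L G = rk G.
    by elim: L {uL f f' fd lo} => //= i L IH G; rewrite !IH mul0r subr0 mul1r add0r.
  by move=> ->; rewrite /rk rank_indep // cards0.
have -> : f 1 = sample_mean x rk L finset.set0.
  by rewrite /f; congr sample_mean; apply/funext => j; rewrite mul1r.
have := sample_rank_le_greedy L x01 F0; rewrite cards0 add0r => H1 H2.
have e0 : 0 < expR 1 :> R := expR_gt0 1.
apply: le_trans _ H1; rewrite -(ler_pM2l e0); apply: le_trans _ (_ : _ <= expR 1 * _ - 0) _.
  by rewrite mulrA mulrBr mulr1 mulfV ?gt_eqF //; apply: H2.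
by rewrite subr0.
Qed.

Lemma probe_matroid x w : ex_ante F x -> (forall i, 0 < w i -> 0 < x i) ->
  exists2 L, uniq L &
    \sum_i w i <= expR 1 / (expR 1 - 1) * probe_value F x w L finset.set0.
Proof.
move=> xF wx; have [L [u [uL sL Lw le_w]]] := decreasing_density wx.
exists L => //; apply: le_trans le_w _.
have e1 : 0 < expR 1 - 1 :> R by rewrite subr_gt0 expR_gt1.
have e0 : 0 < expR 1 :> R := expR_gt0 1.
have tr : transitive (fun i j => u j <= u i).
  by move=> a b c ab bc; apply: le_trans bc ab.
rewrite (sorted_pairwise tr) in sL.
have H := greedy_abel (fun L' => @greedy_matroid x L' xF) uL sL (fun i iL => proj2 (Lw i iL)).
have {}H := le_trans H (greedy_le_probe finset.set0 (ex_ante_bounds xF) (fun i iL => proj1 (Lw i iL))).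
have c0 : 0 <= expR 1 / (expR 1 - 1) :> R by rewrite divr_ge0 // ltW.
apply: le_trans (ler_wpM2l c0 H); rewrite le_eqVlt; apply/orP; left; apply/eqP.
rewrite [LHS]big_seq (eq_bigr (fun i => u i * x i)) => [|i /Lw[]//].
rewrite -big_seq; set S := \sum_(i <- L) _.
by field; rewrite !gt_eqF.
Qed.
End Matroid.

(* [y] and [z] count the expected moves and stops of a flow entering at [r];
   the total of [f] over the flow telescopes to [f r]. *)
Lemma superharmonic_root (R : realType) (S A : finType) (r : S)
    (y : S -> A -> R) (z : S -> R) (tr : S -> A -> S -> R) (c : A -> R)
    (rho f : S -> R) :
  (forall s, \sum_a y s a + z s <=
     (s == r)%:R + \sum_s' \sum_a y s' a * tr s' a s) ->
  (forall s, 0 <= f s) ->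
  (forall s, z s * rho s <= z s * f s) ->
  (forall s, \sum_a y s a * (- c a + \sum_s' tr s a s' * f s') <=
     (\sum_a y s a) * f s) ->
  \sum_s z s * rho s - \sum_s \sum_a y s a * c a <= f r.
Proof.
move=> flow f0 hz hy.
have : \sum_s (\sum_a y s a + z s) * f s <=
    \sum_s ((s == r)%:R + \sum_s' \sum_a y s' a * tr s' a s) * f s.
  by apply: ler_sum => s _; apply: ler_wpM2r.
have : \sum_s (z s * rho s + \sum_a y s a * (- c a + \sum_s' tr s a s' * f s'))
    <= \sum_s (\sum_a y s a + z s) * f s.
  by apply: ler_sum => s _; rewrite mulrDl addrC lerD.
have -> : \sum_s ((s == r)%:R + \sum_s' \sum_a y s' a * tr s' a s) * f s =
    f r + \sum_s \sum_a y s a * \sum_s' tr s a s' * f s'.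
  under eq_bigr => s _ do rewrite mulrDl.
  rewrite big_split /=; congr (_ + _).
    rewrite (bigD1 r) //= eqxx mul1r big1 ?addr0 // => s /negbTE ->.
    by rewrite mul0r.
  under eq_bigr => s _ do rewrite mulr_suml.
  rewrite exchange_big /=; apply: eq_bigr => s _.
  under eq_bigr => s' _ do rewrite mulr_suml.
  rewrite exchange_big /=; apply: eq_bigr => a _.
  by rewrite mulr_sumr; apply: eq_bigr => s' _; rewrite mulrA.
have -> : \sum_s (z s * rho s +
      \sum_a y s a * (- c a + \sum_s' tr s a s' * f s')) =
    \sum_s z s * rho s - \sum_s \sum_a y s a * c a +
    \sum_s \sum_a y s a * \sum_s' tr s a s' * f s'.
  rewrite big_split /= -addrA; congr (_ + _).
  rewrite -sumrN -big_split /=; apply: eq_bigr => s _.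
  rewrite -sumrN -big_split /=; apply: eq_bigr => a _.
  by rewrite mulrDr mulrN.
by lra.
Qed.

(** * Bellman values under a fixed commitment *)

Section Committed.
Variables (R : realType) (n : nat) (I : cics R n).
Hypothesis wfI : wf_cics I.
Variable pi : commitment I.
Hypothesis vpi : valid_commitment pi.
Implicit Types (x : jstate I) (m : nat) (h : history I) (i : 'I_n).

Definition advance_value (V : jstate I -> R) x i : R :=
  \sum_(a : Act I i) pi (x i) a *
    (- cost I a + \sum_(s' : St I i) trans I (x i) a s' * V (dfwith x s')).

Definition decision_value (V : jstate I -> R) x (d : cdecision n) : R :=
  match d with inl A => collect x A | inr i => advance_value V x i end.

Definition best_decision (V : jstate I -> R) x : cdecision n :=
  [arg max_(d > inl finset.set0 | valid_cdecision x d) decision_value V x d]%O.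

Fixpoint bellman m x : R :=
  if m is m'.+1 then
    decision_value (bellman m') x (best_decision (bellman m') x)
  else 0.

Lemma halt_valid x : valid_cdecision x (inl finset.set0).
Proof.
case: wfI => [[_ F0]] _ _ _ _; rewrite /= F0 /=.
by apply/forall_inP => i; rewrite inE.
Qed.

Lemma best_decisionP V x : valid_cdecision x (best_decision V x) /\
  forall d, valid_cdecision x d ->
    decision_value V x d <= decision_value V x (best_decision V x).
Proof.
rewrite /best_decision; case: arg_maxP => [|d vd dmax]; first exact: halt_valid.
by split.
Qed.

Lemma bellman_ge m x d : valid_cdecision x d ->
  decision_value (bellman m) x d <= bellman m.+1 x.
Proof. by have [_ H] := best_decisionP (bellman m) x; apply: H. Qed.

(** A termination measure: by acyclicity a move loses at least the state it leaves from the
    reachable set. *)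
Definition height x : nat := (\sum_(i < n) #|connect (@edge R n I i) (x i)|)%N.

Lemma height_lt_horizon x : (height x < horizon I)%N.
Proof. by rewrite ltnS; apply: leq_sum => i _; apply: max_card. Qed.

Lemma height_decr x i a s' : x i \notin term I i -> a \in avail I (x i) ->
  0 < trans I (x i) a s' -> (height (dfwith x s') < height x)%N.
Proof.
move=> xi aA t0; have e : edge (x i) s' by apply/exists_inP; exists a.
rewrite /height (bigD1 i) //= [X in (_ < X)%N](bigD1 i) //= dfwith_in.
rewrite (eq_bigr (fun j => #|connect (@edge R n I j) (x j)|)) => [|j ji]; last first.
  by rewrite dfwith_out // eq_sym.
rewrite ltn_add2r proper_card //; apply/properP; split.
  apply/subsetP => s; rewrite !inE => c.
  exact: connect_trans (connect1 e) c.
exists (x i); first by rewrite inE connect0.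
by rewrite inE; case: wfI => _ _ _ _; apply.
Qed.

Lemma eq_decision_value V V' x d : valid_cdecision x d ->
  (forall x', (height x' < height x)%N -> V x' = V' x') ->
  decision_value V x d = decision_value V' x d.
Proof.
move=> vd VV; case: d vd => //= i xi; apply: eq_bigr => a _.
have [p0 [p1 pA]] := vpi xi.
have [->|pa] := eqVneq (pi (x i) a) 0; first by rewrite !mul0r.
have {pa} aA : a \in avail I (x i) by apply: pA; rewrite lt_neqAle eq_sym pa p0.
have [_ _ _ wft _] := wfI; have [t0 _] := wft i _ _ aA.
congr (_ * (_ + _)); apply: eq_bigr => s' _.
have [->|ts] := eqVneq (trans I (x i) a s') 0; first by rewrite !mul0r.
by rewrite VV //; apply: height_decr aA _ => //; rewrite lt_neqAle eq_sym ts t0.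
Qed.

(** Every move of positive probability lowers the height, so fuel above it is never exhausted. Hence
    [opt_value] satisfies Bellman inequalities without a fuel index. *)
Lemma bellman_stationary m x : (height x < m)%N -> bellman m.+1 x = bellman m x.
Proof.
elim: m x => // m IH x; rewrite ltnS => hx.
have E d : valid_cdecision x d ->
    decision_value (bellman m.+1) x d = decision_value (bellman m) x d.
  by move=> vd; apply: eq_decision_value => // x' hx'; apply/IH/(leq_trans hx').
apply/eqP; rewrite eq_le; apply/andP; split.
  have [v _] := best_decisionP (bellman m.+1) x.
  by rewrite [leLHS]/= -/(bellman m.+1) (E _ v) bellman_ge.
have [v _] := best_decisionP (bellman m) x.
by rewrite [leLHS]/= -(E _ v) bellman_ge.
Qed.

Definition opt_value x : R := bellman (horizon I) x.

Lemma opt_value_ge x d : valid_cdecision x d ->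
  decision_value opt_value x d <= opt_value x.
Proof.
move=> vd; rewrite [leRHS]/opt_value -bellman_stationary ?height_lt_horizon //.
exact: bellman_ge.
Qed.

(** The length of the history recovers the fuel; the successor accounts for the step being
    decided. *)
Definition bellman_policy : cpolicy I := fun h x =>
  [ffun d => (d == best_decision (bellman (horizon I - (size h).+1)) x)%:R].

Lemma bellman_policy_valid : valid_cpolicy bellman_policy.
Proof.
move=> h x; pose b := best_decision (bellman (horizon I - (size h).+1)) x.
have E d : bellman_policy h x d = (d == b)%:R by rewrite ffunE.
split=> [d|]; first by rewrite E ler0n.
split=> [|d].
  rewrite (bigD1 b) //= E eqxx big1 ?addr0 // => d /negbTE db.
  by rewrite E db.
rewrite E; case: eqP => [->|]; last by rewrite ltxx.
by case: (best_decisionP (bellman (horizon I - (size h).+1)) x).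
Qed.

Lemma cutil_bellman m h x : (size h + m = horizon I)%N ->
  cutil_rec pi bellman_policy m h x = bellman m x.
Proof.
elim: m h x => // m IH h x hm.
have Em : (horizon I - (size h).+1)%N = m by rewrite -hm addnS subSS addKn.
pose b := best_decision (bellman m) x.
have E d : bellman_policy h x d = (d == b)%:R by rewrite ffunE Em.
rewrite /= -/b (bigD1 b) //= E eqxx mul1r [X in _ + X]big1 ?addr0 => [|d db].
  rewrite /decision_value; case: (b) => // i; apply: eq_bigr => a _.
  congr (_ * (_ + _)); apply: eq_bigr => s' _.
  by rewrite IH // size_rcons addSn -addnS.
by rewrite E (negbTE db) mul0r.
Qed.

(** Costs only lower the utility, and a run collects once. The bound makes [ComSup] a genuine
    supremum. *)
Lemma cutil_bounded (Q : cpolicy I) m h x : valid_cpolicy Q ->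
  cutil_rec pi Q m h x <= \sum_i \sum_(s : St I i) `|Defs.val I s|.
Proof.
move=> vQ; set M := \sum_i _.
have M0 : 0 <= M by rewrite sumr_ge0 // => i _; rewrite sumr_ge0.
elim: m h x => // m IH h x /=.
have [Q0 [Q1 Qv]] := vQ h x.
rewrite -[M]mul1r -Q1 mulr_suml; apply: ler_sum => d _.
have [->|Qd] := eqVneq (Q h x d) 0; first by rewrite !mul0r.
apply: ler_wpM2l => //.
have : valid_cdecision x d by apply: Qv; rewrite lt_neqAle eq_sym Qd Q0.
case: d {Qd} => [A _|i /= xi].
  apply: (@le_trans _ _ (\sum_(i in A) \sum_(s : St I i) `|Defs.val I s|)).
    apply: ler_sum => i _; rewrite (bigD1 (x i)) //=.
    by apply: le_trans (ler_norm _) _; rewrite lerDl sumr_ge0.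
  rewrite /M [leRHS](bigID (fun i => i \in A)) /= lerDl.
  by rewrite sumr_ge0 // => i _; rewrite sumr_ge0.
have [p0 [p1 pA]] := vpi xi.
rewrite -[M]mul1r -p1 mulr_suml; apply: ler_sum => a _.
have [->|pa] := eqVneq (pi (x i) a) 0; first by rewrite !mul0r.
apply: ler_wpM2l => //.
have {pa} aA : a \in avail I (x i) by apply: pA; rewrite lt_neqAle eq_sym pa p0.
have [_ _ [c0 _] wft _] := wfI; have [t0 t1] := wft i _ _ aA.
rewrite -[M]add0r; apply: lerD; first by rewrite oppr_le0.
rewrite -[M]mul1r -t1 mulr_suml; apply: ler_sum => s' _.
exact: ler_wpM2l.
Qed.

End Committed.

Lemma opt_value_le_ComSup (R : realType) (n : nat) (I : cics R n)
    (pi : commitment I) : wf_cics I -> valid_commitment pi ->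
  opt_value pi (root_state I) <= ComSup I.
Proof.
move=> wfI vpi; apply: ub_le_sup.
  exists (\sum_i \sum_(s : St I i) `|Defs.val I s|) => _ [pi' [Q [vpi' vQ ->]]].
  exact: cutil_bounded.
exists pi, (bellman_policy pi); split=> //; first exact: bellman_policy_valid.
by rewrite /CUtil cutil_bellman.
Qed.

Lemma dfwith_dfwith (J : eqType) (T : J -> Type) (x : forall i, T i) i (s s' : T i) :
  dfwith (dfwith x s) s' = dfwith x s'.
Proof.
apply/functional_extensionality_dep => j.
have [<-|ji] := eqVneq i j; first by rewrite !dfwith_in.
by rewrite !dfwith_out.
Qed.

Lemma dfwith_id (J : eqType) (T : J -> Type) (x : forall i, T i) i :
  dfwith x (x i) = x.
Proof.
apply/functional_extensionality_dep => j.
have [<-|ji] := eqVneq i j; first by rewrite dfwith_in.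
by rewrite dfwith_out.
Qed.

(** * From flows to a commitment that realizes probing *)

Section Realization.
Variables (R : realType) (n : nat) (I : cics R n).
Hypothesis wfI : wf_cics I.
Variables (y : forall i, St I i -> Act I i -> R) (z : forall i, St I i -> R).
Hypothesis y_ge0 : forall i (s : St I i) a, 0 <= y s a.
Hypothesis z_ge0 : forall i (s : St I i), 0 <= z s.
Hypothesis y_avail : forall i (s : St I i) a, a \notin avail I s -> y s a = 0.
Hypothesis z_term : forall i (s : St I i), s \notin term I i -> z s = 0.
Hypothesis flow : forall i (s : St I i), \sum_a y s a + z s <=
  (s == Defs.root I i)%:R + \sum_s' \sum_a y s' a * trans I s' a s.

(** In a state that the flow never leaves by a move, an arbitrary available action keeps the
    commitment valid. *)
Definition flow_commitment : commitment I := fun i s =>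
  let Y := \sum_a y s a in
  [ffun a => if Y == 0 then ([pick b in avail I s] == Some a)%:R else y s a / Y].

Lemma flow_commitment_valid : valid_commitment flow_commitment.
Proof.
move=> i s sT.
have Y0 : 0 <= \sum_a y s a by apply: sumr_ge0.
have [c cA E] : exists2 c, c \in avail I s & [pick b in avail I s] = Some c.
  case: (pickP (fun b => b \in avail I s)) => [c cA|none]; first by exists c.
  case: wfI => _ wfT _ _ _; move: sT; rewrite wfT => /negP[].
  by apply/eqP/setP => a; rewrite inE; apply: none.
split=> [a|]; first by rewrite ffunE; case: ifP => _; rewrite ?divr_ge0.
split=> [|a].
  under eq_bigr => a _ do rewrite ffunE E.
  have [_|Yn] := eqVneq (\sum_a y s a) 0; last by rewrite -mulr_suml mulfV.
  rewrite (bigD1 c) //= eqxx big1 ?addr0 // => a ac.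
  by rewrite (inj_eq (@Some_inj _)) eq_sym (negbTE ac).
rewrite ffunE E; case: ifPn => [_|Yn].
  by rewrite (inj_eq (@Some_inj _)); case: eqP => [<- //|]; rewrite ltxx.
by apply: contraTT => aA; rewrite y_avail // mul0r ltxx.
Qed.

Lemma flow_commitmentE i (s : St I i) a :
  y s a = (\sum_b y s b) * flow_commitment s a.
Proof.
rewrite ffunE; case: ifPn => [/eqP Y0|Yn]; last by rewrite mulrCA mulfV ?mulr1.
rewrite Y0 mul0r; move/eqP: Y0; rewrite psumr_eq0 // => /allP/(_ a).
by rewrite mem_index_enum => /(_ isT)/eqP.
Qed.

Definition sel_prob i : R := \sum_(s : St I i) z s.
Definition local_util i : R :=
  \sum_(s : St I i) z s * Defs.val I s - \sum_(s : St I i) \sum_a y s a * cost I a.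

Lemma collect_dfwith (x : jstate I) i (s : St I i) (G : {set 'I_n}) :
  i \notin G -> collect (dfwith x s) G = collect x G.
Proof.
move=> iG; apply: eq_bigr => j jG; rewrite dfwith_out //.
by apply: contraNneq iG => ->.
Qed.

Let V := opt_value flow_commitment.

(** MDPs in [G] are finished, those in [L] untouched, and any other may have been abandoned in any
    state; so the induction hypothesis applies wherever the current MDP stops. *)
Lemma probe_le_opt_value (x : jstate I) L (G : {set 'I_n}) :
  uniq L -> G \in fam I -> (forall i, i \in G -> x i \in term I i) ->
  (forall i, i \in L -> i \notin G /\ x i = Defs.root I i) ->
  collect x G + probe_value (fam I) sel_prob local_util L G <= V x.
Proof.
have vpi := flow_commitment_valid.
elim: L x G => [|i L IH] x G uL GF GT Lr.
  rewrite /= addr0.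
  have := @opt_value_ge _ _ _ wfI _ vpi x (inl G); apply; rewrite /= GF /=.
  exact/forall_inP.
have /andP[iL uL'] : (i \notin L) && uniq L by [].
have Lr' j : j \in L -> [/\ j != i, j \notin G & x j = Defs.root I j].
  move=> jL; have [jG xj] : j \notin G /\ x j = Defs.root I j.
    by apply: Lr; rewrite inE jL orbT.
  by split=> //; apply: contraNneq iL => <-.
have [iG xi] := Lr i (mem_head i L).
have skip (s : St I i) :
    collect x G + probe_value (fam I) sel_prob local_util L G <= V (dfwith x s).
  rewrite -(collect_dfwith x s iG); apply: IH => //.
    move=> j jG; rewrite dfwith_out ?GT //.
    by apply: contraNneq iG => ->.
  by move=> j /Lr'[ji jG xj]; rewrite dfwith_out // eq_sym.
have xx : dfwith x (Defs.root I i) = x by rewrite -xi dfwith_id.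
rewrite [probe_value _ _ _ _ _]/=; case: ifPn => [iGF|_]; last first.
  by have := skip (Defs.root I i); rewrite xx.
set p1 := probe_value _ _ _ L (i |: G); set p0 := probe_value _ _ _ L G.
rewrite -/p0 in skip.
rewrite -lerBrDl ge_max; apply/andP; split; last first.
  by rewrite lerBrDl; have := skip (Defs.root I i); rewrite xx.
(* The excess over giving up on [i] in state [s], nonnegative by [skip]. *)
pose f (s : St I i) := V (dfwith x s) - collect x G - p0.
(* Accepting in [s] earns its value and changes the continuation from [p0] to [p1]. *)
pose rho (s : St I i) := Defs.val I s + (p1 - p0).
have f0 s : 0 <= f s by rewrite /f -addrA -opprD subr_ge0.
have accept s : z s * rho s <= z s * f s.
  have [sT|sT] := boolP (s \in term I i); last by rewrite z_term // !mul0r.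
  apply: ler_wpM2l => //.
  have : collect (dfwith x s) (i |: G) + p1 <= V (dfwith x s).
    apply: IH => //.
      move=> j; rewrite !inE; have [-> _|ji /= jG] := eqVneq j i.
        by rewrite dfwith_in.
      by rewrite dfwith_out ?GT // eq_sym.
    move=> j /Lr'[ji jG xj]; rewrite !inE negb_or ji jG dfwith_out //.
    by rewrite eq_sym.
  rewrite /collect big_setU1 //= dfwith_in.
  have := collect_dfwith x s iG; rewrite /collect => -> H.
  by rewrite /rho /f /collect; lra.
have move_on (s : St I i) :
    \sum_a y s a * (- cost I a + \sum_s' trans I s a s' * f s') <=
    (\sum_a y s a) * f s.
  have [sT|sT] := boolP (s \in term I i).
    have [_ wfT _ _ _] := wfI; move: sT; rewrite wfT => /eqP aS.
    have ys a : y s a = 0 by rewrite y_avail // aS inE.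
    by rewrite !big1 ?mul0r // => a _; rewrite ys // mul0r.
  under eq_bigr => a _ do rewrite flow_commitmentE -mulrA.
  rewrite -mulr_sumr; apply: ler_wpM2l; first exact: sumr_ge0.
  have := @opt_value_ge _ _ _ wfI _ vpi (dfwith x s) (inr i).
  rewrite /= dfwith_in => /(_ sT); rewrite /advance_value dfwith_in.
  have [q0 [q1 qA]] := vpi _ _ sT.
  (* The constant shift passes through both averages, since action and transition probabilities sum
     to one. *)
  have -> : \sum_a flow_commitment s a *
      (- cost I a + \sum_s' trans I s a s' * f s') =
    \sum_a flow_commitment s a * (- cost I a +
      \sum_s' trans I s a s' * V (dfwith (dfwith x s) s')) - (collect x G + p0).
    rewrite -[X in _ = _ - X]mul1r -q1 mulr_suml -sumrB.
    apply: eq_bigr => a _; rewrite -mulrBr.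
    have [->|qa] := eqVneq (flow_commitment s a) 0; first by rewrite !mul0r.
    have aA : a \in avail I s by apply: qA; rewrite lt_neqAle eq_sym qa q0.
    have [_ _ _ wft _] := wfI; have [_ t1] := wft i _ _ aA.
    congr (_ * _); rewrite -addrA; congr (_ + _).
    rewrite -[X in _ = _ - X]mul1r -t1 mulr_suml -sumrB.
    apply: eq_bigr => s' _; rewrite -mulrBr dfwith_dfwith.
    by rewrite /f -addrA -opprD.
  by rewrite /f -[V]/(opt_value _) => H; rewrite -addrA -opprD lerB.
have := superharmonic_root (@flow i) f0 accept move_on.
have -> : \sum_s z s * rho s =
    \sum_(s : St I i) z s * Defs.val I s + sel_prob i * (p1 - p0).
  by rewrite mulr_suml -big_split /=; apply: eq_bigr => s _; rewrite mulrDr.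
rewrite /f xx /local_util; lra.
Qed.

End Realization.

(** * Occupancy measures of a policy *)

Section Occupancy.
Variables (R : realType) (n : nat) (I : cics R n).
Hypothesis wfI : wf_cics I.
Variable P : policy I.
Hypothesis vP : valid_policy P.
Implicit Types (x : jstate I) (m : nat) (h : history I) (i : 'I_n).

Let move := {i : 'I_n & Act I i}.
Implicit Types (u : jstate I -> {set 'I_n} -> R) (v : jstate I -> move -> R).

(* Expected total reward of a run that earns [v x d] at each move [d] and
   [u x A] when it halts with [A]. *)
Fixpoint reward u v m h x : R :=
  if m is m'.+1 then
    \sum_(d : decision I) P h x d *
      match d with
      | inl A => u x A
      | inr (existT i a) =>
          v x (existT _ i a) + \sum_(s' : St I i) trans I (x i) a s' *
            reward u v m' (rcons h (existT _ i a, dfwith x s')) (dfwith x s')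
      end
  else 0.

Lemma util_reward m h x : util_rec P m h x =
  reward (fun x A => collect x A) (fun _ d => - cost I (tagged d)) m h x.
Proof.
elim: m h x => //= m IH h x; apply: eq_bigr => -[A|[i a]] _ //.
by congr (_ * (_ + _)); apply: eq_bigr => s' _; rewrite IH.
Qed.

Lemma rewardZ c u v m h x :
  reward (fun x A => c * u x A) (fun x d => c * v x d) m h x = c * reward u v m h x.
Proof.
elim: m h x => [|m IH] h x /=; first by rewrite mulr0.
rewrite mulr_sumr; apply: eq_bigr => -[A|[i a]] _; first by rewrite mulrCA.
rewrite [RHS]mulrCA [in RHS]mulrDr; congr (_ * (_ + _)).
by rewrite mulr_sumr; apply: eq_bigr => s' _; rewrite IH mulrCA.
Qed.

Lemma reward_sum (J : finType) (u : J -> jstate I -> {set 'I_n} -> R)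
    (v : J -> jstate I -> move -> R) m h x :
  reward (fun x A => \sum_j u j x A) (fun x d => \sum_j v j x d) m h x =
  \sum_j reward (u j) (v j) m h x.
Proof.
elim: m h x => [|m IH] h x /=; first by rewrite big1.
rewrite exchange_big /=; apply: eq_bigr => -[A|[i a]] _; rewrite -mulr_sumr //.
rewrite big_split /=; congr (_ * (_ + _)).
rewrite exchange_big /=; apply: eq_bigr => s' _.
by rewrite IH mulr_sumr.
Qed.

Lemma rewardD u v u' v' m h x :
  reward (fun x A => u x A + u' x A) (fun x d => v x d + v' x d) m h x =
  reward u v m h x + reward u' v' m h x.
Proof.
elim: m h x => [|m IH] h x /=; first by rewrite addr0.
rewrite -big_split; apply: eq_bigr => -[A|[i a]] _ /=; rewrite -mulrDr //.
congr (_ * _); rewrite addrACA; congr (_ + _).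
by rewrite -big_split; apply: eq_bigr => s' _; rewrite IH mulrDr.
Qed.

Lemma le_reward u v u' v' m h x :
  (forall x A, valid_decision x (inl A) -> u x A <= u' x A) ->
  (forall x d, valid_decision x (inr d) -> v x d <= v' x d) ->
  reward u v m h x <= reward u' v' m h x.
Proof.
move=> le_u le_v; elim: m h x => //= m IH h x.
have [P0 [_ Pv]] := vP h x.
apply: ler_sum => d _; have [->|Pd] := eqVneq (P h x d) 0; first by rewrite !mul0r.
have : valid_decision x d by apply: Pv; rewrite lt_neqAle eq_sym Pd P0.
case: d Pd => [A|[i a]] Pd vd; apply: ler_wpM2l => //.
  exact: le_u.
apply: lerD; first exact: le_v.
have /andP[_ aA] := vd; have [_ _ _ wft _] := wfI; have [t0 _] := wft i _ _ aA.
by apply: ler_sum => s' _; apply: ler_wpM2l.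
Qed.

Lemma eq_reward u v u' v' m h x :
  (forall x A, valid_decision x (inl A) -> u x A = u' x A) ->
  (forall x d, valid_decision x (inr d) -> v x d = v' x d) ->
  reward u v m h x = reward u' v' m h x.
Proof.
move=> eq_u eq_v; apply/eqP; rewrite eq_le.
by apply/andP; split; apply: le_reward => *; rewrite ?eq_u ?eq_v.
Qed.

Lemma reward0 m h x : reward (fun _ _ => 0) (fun _ _ => 0) m h x = 0.
Proof.
rewrite -[RHS](mul0r (reward (fun _ _ => 0) (fun _ _ => 0) m h x)) -rewardZ.
by apply: eq_reward => *; rewrite mul0r.
Qed.

Lemma reward_ge0 u v m h x :
  (forall x A, 0 <= u x A) -> (forall x d, 0 <= v x d) -> 0 <= reward u v m h x.
Proof. by move=> u0 v0; rewrite -(reward0 m h x); apply: le_reward. Qed.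

Lemma reward_halt_le1 m h x : reward (fun _ _ => 1) (fun _ _ => 0) m h x <= 1.
Proof.
elim: m h x => //= m IH h x; have [P0 [P1 Pv]] := vP h x.
rewrite -[leRHS]P1; apply: ler_sum => d _.
have [->|Pd] := eqVneq (P h x d) 0; first by rewrite !mul0r.
have : valid_decision x d by apply: Pv; rewrite lt_neqAle eq_sym Pd P0.
rewrite -[leRHS]mulr1; case: d Pd => [A|[i a]] Pd; first by [].
move=> /andP[_ aA]; apply: ler_wpM2l => //; rewrite add0r.
have [_ _ _ wft _] := wfI; have [t0 t1] := wft i _ _ aA.
rewrite -[leRHS]t1; apply: ler_sum => s' _.
by rewrite -[leRHS]mulr1; apply: ler_wpM2l.
Qed.

(** The increments of [f] along a run cancel; what remains is the mean of [f] where the fuel runs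
    out. *)
Lemma reward_telescope (f : jstate I -> R) m h x : (forall x, 0 <= f x) ->
  0 <= f x + reward (fun x _ => - f x) (fun x d =>
    \sum_s' trans I (x (tag d)) (tagged d) s' * f (dfwith x s') - f x) m h x.
Proof.
move=> f0; elim: m h x => [|m IH] h x /=; first by rewrite addr0.
have [P0 [P1 Pv]] := vP h x.
rewrite -{1}[f x]mul1r -P1 mulr_suml -big_split /=; apply: sumr_ge0 => d _.
have [->|Pd] := eqVneq (P h x d) 0; first by rewrite !mul0r addr0.
have : valid_decision x d by apply: Pv; rewrite lt_neqAle eq_sym Pd P0.
rewrite -mulrDr; case: d Pd => [A|[i a]] Pd; first by rewrite subrr mulr0.
move=> /andP[_ aA]; apply: mulr_ge0 => //=.
have [_ _ _ wft _] := wfI; have [t0 _] := wft i _ _ aA.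
rewrite addrA [f x + _]addrC subrK -big_split /=; apply: sumr_ge0 => s' _.
by rewrite -mulrDr mulr_ge0.
Qed.

Let run u v := reward u v (horizon I) [::] (root_state I).

(** Being rewards of indicators, the occupancies inherit linearity from [reward], so their
    identities reduce to pointwise ones. *)
Definition stops i (s : St I i) : R :=
  run (fun x A => ((i \in A) && (x i == s))%:R) (fun _ _ => 0).

Definition moves i (s : St I i) (a : Act I i) : R :=
  run (fun _ _ => 0)
    (fun x d => ((d == Tagged (Act I) a) && (x i == s))%:R).

Lemma stops_ge0 i (s : St I i) : 0 <= stops s.
Proof. by apply: reward_ge0 => *; rewrite ?ler0n. Qed.

Lemma moves_ge0 i (s : St I i) a : 0 <= moves s a.
Proof. by apply: reward_ge0 => *; rewrite ?ler0n. Qed.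

Lemma stops_term i (s : St I i) : s \notin term I i -> stops s = 0.
Proof.
move=> sT; rewrite -(reward0 (horizon I) [::] (root_state I)).
apply: eq_reward => // x A /= /andP[_ /forall_inP AT].
case: (boolP (i \in A)) => //= iA; case: eqP => // xs.
by move: sT; rewrite -xs AT.
Qed.

Lemma moves_avail i (s : St I i) a : a \notin avail I s -> moves s a = 0.
Proof.
move=> aA; rewrite -(reward0 (horizon I) [::] (root_state I)).
apply: eq_reward => // x d vd; case: eqP => //= dE; case: eqP => // xs.
by move: vd aA; rewrite dE /= xs => /andP[_ ->].
Qed.

Lemma sum_indicator_mul (T : finType) (t : T) (g : T -> R) :
  \sum_s g s * (t == s)%:R = g t.
Proof.
rewrite (bigD1 t) //= eqxx mulr1 big1 ?addr0 // => s st.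
by rewrite eq_sym (negbTE st) mulr0.
Qed.

Lemma stops_sum i (g : St I i -> R) : \sum_s g s * stops s =
  run (fun x A => (i \in A)%:R * g (x i)) (fun _ _ => 0).
Proof.
transitivity (run (fun x A => \sum_s g s * ((i \in A) && (x i == s))%:R)
    (fun _ _ => \sum_(s : St I i) 0)).
  rewrite [RHS]reward_sum; apply: eq_bigr => s _; rewrite -rewardZ.
  by apply: eq_reward => // x d _; rewrite mulr0.
apply: eq_reward => [x A _|x d _]; last by rewrite big1.
under eq_bigr => s _ do rewrite -mulnb natrM mulrCA.
by rewrite -mulr_sumr sum_indicator_mul.
Qed.

(** Summing over indicators extends [g] by zero to the moves of other MDPs without a cast between
    action types. *)
Definition at_move i (g : St I i -> Act I i -> R) x (d : move) : R :=
  \sum_s \sum_a g s a * ((d == Tagged (Act I) a) && (x i == s))%:R.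

Lemma at_move_eq i (g : St I i -> Act I i -> R) x a :
  at_move g x (Tagged (Act I) a) = g (x i) a.
Proof.
rewrite -(sum_indicator_mul (x i) (fun s => g s a)); apply: eq_bigr => s _.
rewrite -(sum_indicator_mul a (g s)) mulr_suml; apply: eq_bigr => b _.
by rewrite eq_Tagged -mulnb natrM mulrA.
Qed.

Lemma at_move_neq i (g : St I i -> Act I i -> R) x (d : move) :
  tag d != i -> at_move g x d = 0.
Proof.
move=> di; rewrite /at_move big1 // => s _; rewrite big1 // => a _.
suff -> : (d == Tagged (Act I) a) = false by rewrite mulr0.
by apply/eqP => E; rewrite E eqxx in di.
Qed.

Lemma moves_sum i (g : St I i -> Act I i -> R) :
  \sum_s \sum_a g s a * moves s a = run (fun _ _ => 0) (at_move g).
Proof.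
transitivity (run (fun _ _ => \sum_(s : St I i) \sum_(a : Act I i) 0) (at_move g)).
  rewrite [RHS]reward_sum; apply: eq_bigr => s _.
  rewrite [RHS]reward_sum; apply: eq_bigr => a _; rewrite -rewardZ.
  by apply: eq_reward => // x A _; rewrite mulr0.
by apply: eq_reward => // x A _; rewrite big1 // => s _; rewrite big1.
Qed.

(** Telescope the indicator that MDP [i] is in state [s]. *)
Lemma occupancy_flow i (s : St I i) : \sum_a moves s a + stops s <=
  (s == Defs.root I i)%:R + \sum_s' \sum_a moves s' a * trans I s' a s.
Proof.
pose f x : R := (x i == s)%:R.
have := @reward_telescope f (horizon I) [::] (root_state I) (fun _ => ler0n _ _).
rewrite {1}/f {1}/root_state [_ == s]eq_sym.
set T := reward _ _ _ _ _.
pose g s' a := trans I s' a s - (s' == s)%:R.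
suff : T <= \sum_s' \sum_a g s' a * moves s' a + \sum_s' - (s == s')%:R * stops s'.
  have -> : \sum_s' - (s == s')%:R * stops s' = - stops s.
    rewrite -[RHS](sum_indicator_mul s (fun s' => - stops s')).
    by apply: eq_bigr => s' _; rewrite mulNr mulrC mulNr.
  have -> : \sum_s' \sum_a g s' a * moves s' a =
      \sum_s' \sum_a moves s' a * trans I s' a s - \sum_a moves s a.
    rewrite -[\sum_a moves s a](sum_indicator_mul s (fun s' => \sum_a moves s' a)).
    rewrite -sumrB; apply: eq_bigr => s' _.
    rewrite mulr_suml -sumrB; apply: eq_bigr => a _.
    by rewrite mulrC mulrBr [s' == s]eq_sym.
  by lra.
rewrite moves_sum (stops_sum (fun s' => - (s == s')%:R)) -[run _ _ + _]rewardD.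
apply: le_reward => [x A _|x [j b] /= /andP[_ bA]].
  (* An inequality only: a run may halt with [i] in [s] but not selected. *)
  rewrite add0r mulrN lerN2 -natrM ler_nat /f [s == _]eq_sym.
  by case: (i \in A); rewrite ?mul1n.
have [_ _ _ wft _] := wfI; have [_ t1] := wft j _ _ bA.
rewrite addr0 /f; have [ji|ij] := eqVneq j i; last first.
  (* A move of another MDP leaves the state of [i], hence [f], unchanged. *)
  rewrite at_move_neq // -[X in _ - X]mul1r -t1 mulr_suml -sumrB.
  by rewrite sumr_le0 // => s' _; rewrite dfwith_out // subrr.
case: _ / ji s @f @T @g b bA t1 => s f T g b bA t1.
rewrite at_move_eq /g lerD2r.
under eq_bigr => s' _ do rewrite dfwith_in eq_sym.
by rewrite (sum_indicator_mul s (fun s' => trans I (x j) b s')).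
Qed.

Lemma occupancy_ex_ante : ex_ante (fam I) (sel_prob stops).
Proof.
exists (fun A => run (fun _ B => (B == A)%:R) (fun _ _ => 0)); split.
- by move=> A; apply: reward_ge0 => *; rewrite ?ler0n.
- move=> A AF; rewrite -[RHS](reward0 (horizon I) [::] (root_state I)).
  apply: eq_reward => // x B /= /andP[BF _]; case: eqP => // BA.
  by rewrite BA (negbTE AF) in BF.
- rewrite -reward_sum; apply: le_trans (reward_halt_le1 (horizon I) [::] (root_state I)).
  apply: le_reward => [x A _|x d _]; last by rewrite big1.
  by have := sum_indicator_mul A (fun=> 1); under eq_bigr do rewrite mul1r; move=> ->.
move=> i; rewrite /sel_prob.
under eq_bigr => s _ do rewrite -[stops s]mul1r.
rewrite (stops_sum (fun=> 1)).
transitivity (\sum_(A : {set 'I_n})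
    (i \in A)%:R * run (fun _ B => (B == A)%:R) (fun _ _ => 0)).
  under [RHS]eq_bigr => A _ do rewrite -rewardZ.
  rewrite -[RHS]reward_sum; apply: eq_reward => [x A _|x d _].
    by rewrite mulr1 (sum_indicator_mul A (fun B => (i \in B)%:R)).
  by rewrite big1 // => A _; rewrite mulr0.
rewrite [RHS]big_mkcond; apply: eq_bigr => A _.
by case: ifP => _; rewrite ?mul1r ?mul0r.
Qed.

Lemma util_occupancy : Util P = \sum_i local_util moves stops i.
Proof.
rewrite /Util util_reward.
transitivity (\sum_i run (fun x A => (i \in A)%:R * Defs.val I (x i))
    (at_move (fun (s : St I i) a => - cost I a))).
  rewrite -reward_sum; apply: eq_reward => [x A _|x [j b] _].
    rewrite /collect big_mkcond; apply: eq_bigr => i _.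
    by case: (i \in A); rewrite ?mul1r ?mul0r.
  rewrite (bigD1 j) //= at_move_eq big1 ?addr0 // => i ij.
  by rewrite at_move_neq // eq_sym.
apply: eq_bigr => i _; rewrite /local_util -sumrN.
under eq_bigr => s _ do rewrite mulrC.
under [X in _ + X]eq_bigr => s _ do rewrite -sumrN.
under [X in _ + X]eq_bigr => s _ do under eq_bigr => a _ do rewrite -mulrN mulrC.
rewrite stops_sum moves_sum -[RHS]rewardD.
by apply: eq_reward => *; rewrite ?addr0 ?add0r.
Qed.

End Occupancy.

(** * Reduction of the commitment gap to probing *)

Section Reduction.
Variables (R : realType) (n : nat) (I : cics R n).
Hypothesis wfI : wf_cics I.

Lemma sequential_lower_bound (P : policy I) : valid_policy P ->
  exists x w, [/\ ex_ante (fam I) x, forall i, 0 < w i -> 0 < x i,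
    Util P = \sum_i w i &
    forall L, uniq L -> probe_value (fam I) x w L finset.set0 <= ComSup I].
Proof.
move=> vP; exists (sel_prob (@stops _ _ _ P)), (local_util (@moves _ _ _ P) (@stops _ _ _ P)).
have y0 := moves_ge0 wfI vP; have z0 := stops_ge0 wfI vP.
split.
- exact: occupancy_ex_ante.
(* An MDP that is never selected contributes only its costs. *)
- move=> i; apply: contraTT; rewrite -!leNgt => x0.
  have {}x0 : sel_prob (@stops _ _ _ P) i = 0.
    by apply/eqP; rewrite eq_le x0 sumr_ge0.
  rewrite /local_util big1 => [|s _]; last first.
    by move/eqP: x0; rewrite psumr_eq0 // => /allP/(_ s); rewrite mem_index_enum
      => /(_ isT)/eqP ->; rewrite mul0r.
  have [_ _ [c0 _] _ _] := wfI.
  by rewrite add0r oppr_le0 sumr_ge0 // => s _; rewrite sumr_ge0 // => a _; rewrite mulr_ge0.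
- exact: util_occupancy.
move=> L uL.
have yA := moves_avail wfI vP; have zT := stops_term wfI vP.
have fl := occupancy_flow wfI vP.
apply: le_trans (opt_value_le_ComSup wfI (flow_commitment_valid wfI y0 yA)).
have := probe_le_opt_value wfI y0 z0 yA zT fl (x := root_state I) (G := finset.set0) uL.
rewrite /collect big_set0 add0r; apply.
- by case: wfI => [[]].
- by move=> i; rewrite inE.
- by move=> i _; rewrite inE.
Qed.

Lemma comgap_le_probe alpha : 0 <= alpha ->
  (forall x w, ex_ante (fam I) x -> (forall i, 0 < w i -> 0 < x i) ->
    exists2 L, uniq L &
      \sum_i w i <= alpha * probe_value (fam I) x w L finset.set0) ->
  comgap_le I alpha.
Proof.
move=> alpha0 H.
(* Halting at once with nothing shows that the set defining [OPT] is inhabited and, through the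
   empty probing order, that [ComSup] is nonnegative. *)
have vH : valid_policy ((fun _ _ => [ffun d => (d == inl finset.set0)%:R]) : policy I).
  move=> h x; split=> [d|]; first by rewrite ffunE ler0n.
  split=> [|d].
    under eq_bigr => d _ do rewrite ffunE.
    by rewrite (bigD1 (inl finset.set0)) //= eqxx big1 ?addr0 // => d /negbTE ->.
  rewrite ffunE; case: eqP => [-> _|]; last by rewrite ltxx.
  exact: halt_valid.
have CS0 : 0 <= ComSup I.
  have [x [w [_ _ _ /(_ [::] isT)]]] := sequential_lower_bound vH.
  by [].
have le_opt : OPT I <= alpha * ComSup I.
  apply: ge_sup; first by eexists; eexists; first exact: vH.
  move=> _ [P vP ->].
  have [x [w [xF wx -> lo]]] := sequential_lower_bound vP.
  have [L uL hL] := H x w xF wx.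
  by apply: le_trans hL _; apply: ler_wpM2l => //; apply: lo.
split=> //; rewrite /ComGap.
(* If [ComSup] is 0, the quotient is 0 by the convention for inverses, and [0 <= alpha] suffices. *)
move: CS0; rewrite le_eqVlt => /orP[/eqP<-|CS0]; first by rewrite invr0 mulr0.
by rewrite ler_pdivrMr.
Qed.

End Reduction.

Theorem theorem5 (R : realType) (n : nat) (I : cics R n) :
  wf_cics I ->
  [/\ (matroid_indep (fam I) -> comgap_le I (expR 1 / (expR 1 - 1))),
      (forall k : nat, k_system k (fam I) -> comgap_le I (k%:R + 1)) &
      (knapsack R (fam I) -> comgap_le I (3135%:R / 1000%:R))].
Proof.
move=> wfI; have [[F_down F0] _ _ _ _] := wfI.
split=> [mF|k kF|[s [s01 Fs]]]; apply: comgap_le_probe => //.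
- by rewrite divr_ge0 ?expR_ge0 // subr_ge0 -[leLHS]expR0 ler_expR.
- by move=> x w xF wx; apply: probe_matroid.
- by rewrite addr_ge0.
- by move=> x w xF wx; apply: probe_ksystem.
- by lra.
move=> x w xF _; have [L uL hL] := probe_knapsack s01 Fs w xF.
exists L => //; apply: le_trans hL _; apply: ler_wpM2r; first exact: probe_value_ge0.
by lra.
Qed.
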